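(* Let $\Omega\subseteq\mathbb{H}$ be a non-empty circular domain and let $f=f_0+f_v$ and $g=g_0+g_v$ be slice-regular functions on $\Omega$. Then their $*$-product is given by $$f*g=f_0g_0-\langle f_v,g_v\rangle_*+f_0g_v+g_0f_v+f_v\wedge_* g_v.$$
   Context: $\mathbb{H}$ is the algebra of quaternions (with the Euclidean topology of $\mathbb{R}^4$), with conjugation $q\mapsto q^c$, and $\mathbb{S}=\{q\in\mathbb{H}: q^2=-1\}$. For $D\subseteq\mathbb{C}=\{\alpha+\imath\beta:\alpha,\beta\in\mathbb{R}\}$ invariant under complex conjugation, $\Omega_D=\{\alpha+\beta I:\alpha+\imath\beta\in D,\ I\in\mathbb{S}\}$; sets of this form are called circular, and a circular domain is a connected open circular subset of $\mathbb{H}$. A stem function is $F=F_1+\imath F_2:D\to\mathbb{H}\otimes_{\mathbb{R}}\mathbb{C}$ ($F_1,F_2$ $\mathbb{H}$-valued) with $F(\overline z)=\overline{F(z)}$, where $\overline{p+\imath q}=p-\imath q$. It induces the slice function $f=\mathcal{I}(F):\Omega_D\to\mathbb{H}$, $f(\alpha+\beta I)=F_1(\alpha+\imath\beta)+I F_2(\alpha+\imath\beta)$. On a circular domain $\Omega=\Omega_D$, $f=\mathcal I(F)$ is slice-regular if $F$ is holomorphic for the natural complex structures of $\mathbb{C}$ and $\mathbb{H}\otimes_{\mathbb{R}}\mathbb{C}$; $\mathcal{SR}(\Omega)$ is the set of slice-regular functions, and $f$ is slice-preserving if $F_1,F_2$ are real-valued. The $*$-product is $\mathcal I(F)*\mathcal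 I(G)=\mathcal I(FG)$, with $(p+\imath q)(p'+\imath q')=pp'-qq'+\imath(pq'+qp')$; if one factor is slice-preserving it is the pointwise product. For $f=\mathcal I(F_1+\imath F_2)\in\mathcal{SR}(\Omega)$: $f^c=\mathcal I(F_1^c+\imath F_2^c)$, $f_0=\frac{f+f^c}{2}$ (which is slice-preserving), $f_v=\frac{f-f^c}{2}$, so $f=f_0+f_v$. For $f,g\in\mathcal{SR}(\Omega)$: $f\wedge_* g=\frac{f*g-g*f}{2}$ and $\langle f,g\rangle_*=(f*g^c)_0$. *)

(* Defs.v *)
From HB Require Import structures.
From mathcomp Require Import all_boot all_order all_algebra ring lra.
From mathcomp Require Import complex.
From mathcomp Require Import boolp classical_sets reals topology normedtype derive.
Import Order.TTheory GRing.Theory Num.Theory.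
Import numFieldNormedType.Exports.

Set Implicit Arguments.
Unset Strict Implicit.
Unset Printing Implicit Defensive.

Local Open Scope classical_set_scope.
Local Open Scope ring_scope.
Local Open Scope complex_scope.

(* [quat K] is the K-algebra with basis 1, i, j, k and Hamilton's relations, on
   the normed K-space of row vectors.  [quat R] is the algebra of quaternions,
   with the Euclidean topology of R^4; [quat R[i]] is its complexification. *)
Definition quat (K : Type) : Type := 'rV[K]_4.

#[warning="-redundant-canonical-projection"]
HB.instance Definition _ (K : numFieldType) :=
  NormedModule.copy (quat K) 'rV[K]_4.

Section Quaternions.
Variable K : numFieldType.

Definition Quat (a b c d : K) : quat K := \row_(i < 4) [:: a; b; c; d]`_i.

Definition quat_re (q : quat K) : K := q 0 0.
Definition quat_i (q : quat K) : K := q 0 1.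
Definition quat_j (q : quat K) : K := q 0 2.
Definition quat_k (q : quat K) : K := q 0 3.

Lemma quatP (p q : quat K) :
  quat_re p = quat_re q -> quat_i p = quat_i q ->
  quat_j p = quat_j q -> quat_k p = quat_k q -> p = q.
Proof.
move=> h0 h1 h2 h3; apply/rowP => -[[|[|[|[|//]]]] h] /=.
- by rewrite (_ : Ordinal h = 0) //; apply: val_inj.
- by rewrite (_ : Ordinal h = 1) //; apply: val_inj.
- by rewrite (_ : Ordinal h = 2) //; apply: val_inj.
- by rewrite (_ : Ordinal h = 3) //; apply: val_inj.
Qed.

Lemma quat_reE a b c d : quat_re (Quat a b c d) = a. Proof. exact: mxE. Qed.
Lemma quat_iE a b c d : quat_i (Quat a b c d) = b. Proof. exact: mxE. Qed.
Lemma quat_jE a b c d : quat_j (Quat a b c d) = c. Proof. exact: mxE. Qed.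
Lemma quat_kE a b c d : quat_k (Quat a b c d) = d. Proof. exact: mxE. Qed.
Definition QuatE := (quat_reE, quat_iE, quat_jE, quat_kE).

Lemma quat_reD p q : quat_re (p + q) = quat_re p + quat_re q.
Proof. exact: mxE. Qed.
Lemma quat_iD p q : quat_i (p + q) = quat_i p + quat_i q.
Proof. exact: mxE. Qed.
Lemma quat_jD p q : quat_j (p + q) = quat_j p + quat_j q.
Proof. exact: mxE. Qed.
Lemma quat_kD p q : quat_k (p + q) = quat_k p + quat_k q.
Proof. exact: mxE. Qed.
Lemma quat_reN p : quat_re (- p) = - quat_re p. Proof. exact: mxE. Qed.
Lemma quat_iN p : quat_i (- p) = - quat_i p. Proof. exact: mxE. Qed.
Lemma quat_jN p : quat_j (- p) = - quat_j p. Proof. exact: mxE. Qed.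
Lemma quat_kN p : quat_k (- p) = - quat_k p. Proof. exact: mxE. Qed.
Lemma quat_reZ a p : quat_re (a *: p) = a * quat_re p. Proof. exact: mxE. Qed.
Lemma quat_iZ a p : quat_i (a *: p) = a * quat_i p. Proof. exact: mxE. Qed.
Lemma quat_jZ a p : quat_j (a *: p) = a * quat_j p. Proof. exact: mxE. Qed.
Lemma quat_kZ a p : quat_k (a *: p) = a * quat_k p. Proof. exact: mxE. Qed.
Lemma quat_re0 : quat_re 0 = 0. Proof. exact: mxE. Qed.
Lemma quat_i0 : quat_i 0 = 0. Proof. exact: mxE. Qed.
Lemma quat_j0 : quat_j 0 = 0. Proof. exact: mxE. Qed.
Lemma quat_k0 : quat_k 0 = 0. Proof. exact: mxE. Qed.
Definition quat_linE :=
  (quat_reD, quat_iD, quat_jD, quat_kD, quat_reN, quat_iN, quat_jN, quat_kN,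
   quat_reZ, quat_iZ, quat_jZ, quat_kZ, (quat_re0, quat_i0, quat_j0, quat_k0)).

Definition quat_mul (p q : quat K) : quat K :=
  let: (a, b, c, d) := (quat_re p, quat_i p, quat_j p, quat_k p) in
  let: (a', b', c', d') := (quat_re q, quat_i q, quat_j q, quat_k q) in
  Quat (a * a' - b * b' - c * c' - d * d')
       (a * b' + b * a' + c * d' - d * c')
       (a * c' - b * d' + c * a' + d * b')
       (a * d' + b * c' - c * b' + d * a').

Definition quat_one : quat K := Quat 1 0 0 0.

Definition quat_conj (q : quat K) : quat K :=
  Quat (quat_re q) (- quat_i q) (- quat_j q) (- quat_k q).

Fact quat_mulA : associative quat_mul.
Proof. by move=> p q r; apply: quatP; rewrite /quat_mul !QuatE; ring. Qed.
Fact quat_mul1l : left_id quat_one quat_mul.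
Proof.
by move=> p; apply: quatP; rewrite /quat_mul /quat_one !QuatE; ring.
Qed.
Fact quat_mul1r : right_id quat_one quat_mul.
Proof.
by move=> p; apply: quatP; rewrite /quat_mul /quat_one !QuatE; ring.
Qed.
Fact quat_mulDl : left_distributive quat_mul +%R.
Proof.
by move=> p q r; apply: quatP; rewrite /quat_mul !(QuatE, quat_linE); ring.
Qed.
Fact quat_mulDr : right_distributive quat_mul +%R.
Proof.
by move=> p q r; apply: quatP; rewrite /quat_mul !(QuatE, quat_linE); ring.
Qed.
Fact quat_one_neq0 : quat_one != 0.
Proof.
apply/eqP => /(congr1 quat_re); rewrite QuatE quat_linE.
by move/eqP; rewrite oner_eq0.
Qed.

HB.instance Definition _ := GRing.Zmodule_isNzRing.Build (quat K)
  quat_mulA quat_mul1l quat_mul1r quat_mulDl quat_mulDr quat_one_neq0.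

Fact quat_scaleAl (a : K) (p q : quat K) : a *: (p * q) = (a *: p) * q.
Proof.
by apply: quatP; rewrite /GRing.mul /= /quat_mul !(QuatE, quat_linE); ring.
Qed.
HB.instance Definition _ :=
  GRing.Lmodule_isLalgebra.Build K (quat K) quat_scaleAl.

Fact quat_scaleAr (a : K) (p q : quat K) : a *: (p * q) = p * (a *: q).
Proof.
by apply: quatP; rewrite /GRing.mul /= /quat_mul !(QuatE, quat_linE); ring.
Qed.
HB.instance Definition _ :=
  GRing.Lalgebra_isAlgebra.Build K (quat K) quat_scaleAr.

Lemma quat_mulE (p q : quat K) : p * q = quat_mul p q. Proof. by []. Qed.
Lemma quat_1E : 1 = Quat 1 0 0 0. Proof. by []. Qed.

End Quaternions.

Section Complexification.
Variable R : realType.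
Implicit Types (p q : quat R) (w : quat R[i]).

(* p + ı q, for p and q quaternions *)
Definition cquat p q : quat R[i] := \row_(n < 4) (p 0 n +i* q 0 n).
Definition cquat_Re w : quat R := map_mx (@complex.Re R) w.
Definition cquat_Im w : quat R := map_mx (@complex.Im R) w.

Lemma cquatK w : cquat (cquat_Re w) (cquat_Im w) = w.
Proof. by apply/rowP => n; rewrite !mxE; case: (w 0 n). Qed.
Lemma cquat_ReE p q : cquat_Re (cquat p q) = p.
Proof. by apply/rowP => n; rewrite !mxE. Qed.
Lemma cquat_ImE p q : cquat_Im (cquat p q) = q.
Proof. by apply/rowP => n; rewrite !mxE. Qed.

Lemma cquat_mulE p q p' q' :
  cquat p q * cquat p' q' = cquat (p * p' - q * q') (p * q' + q * p').
Proof.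
have reE a b : quat_re (cquat a b) = quat_re a +i* quat_re b by exact: mxE.
have iE a b : quat_i (cquat a b) = quat_i a +i* quat_i b by exact: mxE.
have jE a b : quat_j (cquat a b) = quat_j a +i* quat_j b by exact: mxE.
have kE a b : quat_k (cquat a b) = quat_k a +i* quat_k b by exact: mxE.
apply: quatP; rewrite !quat_mulE /quat_mul !(QuatE, reE, iE, jE, kE, quat_linE);
  by apply/eqP; rewrite eq_complex /=; apply/andP; split; apply/eqP; ring.
Qed.

Lemma cquat_scaleiE p q : 'i *: cquat p q = cquat (- q) p.
Proof.
apply/rowP => n; rewrite !mxE.
by apply/eqP; rewrite eq_complex /=; apply/andP; split; apply/eqP; ring.
Qed.

Definition cquat_bar w : quat R[i] := cquat (cquat_Re w) (- cquat_Im w).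
Definition cquat_conj w : quat R[i] :=
  cquat (quat_conj (cquat_Re w)) (quat_conj (cquat_Im w)).

End Complexification.

Section SliceFunctions.
Variable R : realType.
Implicit Types (Om : set (quat R)) (D : set R[i]) (I q : quat R) (z : R[i]).
Implicit Types (F : R[i] -> quat R[i]) (f g : quat R -> quat R).

Definition unit_sphere : set (quat R) := [set I | I ^+ 2 = - 1].

(* α + β I, for z = α + ı β *)
Definition slice_point z I : quat R := (complex.Re z)%:A + complex.Im z *: I.

Definition conj_invariant D := forall z, D z -> D (conjc z).

Definition circularization D : set (quat R) :=
  [set q | exists z I, [/\ D z, unit_sphere I & q = slice_point z I]].

Definition circular Om :=
  exists2 D, conj_invariant D & Om = circularization D.

(* [connected set0] holds. *)
Definition circular_domain Om := [/\ circular Om, open Om & connected Om].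

(* For circular Om, the set D with Om = circularization D: see
   circularization_planeK and plane_circularizationK. *)
Definition plane Om : set R[i] :=
  [set z | exists2 I, unit_sphere I & Om (slice_point z I)].

Definition stem_function D F :=
  forall z, D z -> F (conjc z) = cquat_bar (F z).

(* Complex differentiability.  It only depends on F near z, so that for open D
   it does not involve the values of F outside D. *)
Definition holomorphic_on D F :=
  forall z, D z -> derivable (F : R[i]^o -> quat R[i]) z 1.

(* I(F).  The value is well defined by slice_funE; it is 0 outside Om. *)
Definition slice_fun Om F : quat R -> quat R := fun q =>
  xget 0 [set y | exists z I, [/\ plane Om z, unit_sphere I,
    q = slice_point z I & y = cquat_Re (F z) + I * cquat_Im (F z)]].

(* f = I(F) on Om *)
Definition induces Om F f :=
  stem_function (plane Om) F /\ forall q, Om q -> f q = slice_fun Om F q.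

Definition slice_regular Om f :=
  exists2 F, holomorphic_on (plane Om) F & induces Om F f.

(* The stem function inducing f; it is unique on the plane set of Om by
   stemE, and arbitrary when f is not a slice function. *)
Definition stem Om f : R[i] -> quat R[i] :=
  xget (fun=> 0) [set F | induces Om F f].

Definition star Om f g : quat R -> quat R :=
  slice_fun Om (fun z => stem Om f z * stem Om g z).

Definition sconj Om f : quat R -> quat R :=
  slice_fun Om (fun z => cquat_conj (stem Om f z)).

Definition scal_part Om f : quat R -> quat R :=
  fun q => 2^-1 *: (f q + sconj Om f q).

Definition vec_part Om f : quat R -> quat R :=
  fun q => 2^-1 *: (f q - sconj Om f q).

Definition star_wedge Om f g : quat R -> quat R :=
  fun q => 2^-1 *: (star Om f g q - star Om g f q).

Definition star_inner Om f g : quat R -> quat R :=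
  scal_part Om (star Om f (sconj Om g)).

Lemma unit_sphereP I : unit_sphere I ->
  quat_re I = 0 /\ quat_i I ^+ 2 + quat_j I ^+ 2 + quat_k I ^+ 2 = 1.
Proof.
rewrite /unit_sphere /= expr2 => E.
have := congr1 (@quat_re _) E; have := congr1 (@quat_i _) E.
have := congr1 (@quat_j _) E; have := congr1 (@quat_k _) E.
rewrite !quat_mulE /quat_mul quat_1E !quat_linE !QuatE.
move: (quat_re I) (quat_i I) (quat_j I) (quat_k I) => a b c d h3 h2 h1 h0.
have ab : a * b = 0 by lra.
have ac : a * c = 0 by lra.
have ad : a * d = 0 by lra.
have a0 : a = 0.
  apply/eqP; apply/negPn/negP => aN0.
  have b0 : b = 0 by apply: (mulfI aN0); rewrite ab mulr0.
  have c0 : c = 0 by apply: (mulfI aN0); rewrite ac mulr0.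
  have d0 : d = 0 by apply: (mulfI aN0); rewrite ad mulr0.
  move: h0; rewrite b0 c0 d0; nra.
split=> //; move: h0; rewrite a0; nra.
Qed.

Lemma unit_sphereN I : unit_sphere I -> unit_sphere (- I).
Proof. by rewrite /unit_sphere /= sqrrN. Qed.

Lemma unit_sphere_i : unit_sphere (Quat 0 1 0 0).
Proof.
rewrite /unit_sphere /= expr2.
by apply: quatP; rewrite quat_mulE quat_1E /quat_mul !(QuatE, quat_linE); ring.
Qed.

Lemma slice_point_conj z I : slice_point (conjc z) (- I) = slice_point z I.
Proof. by case: z => a b; rewrite /slice_point /= scalerN scaleNr opprK. Qed.

Lemma slice_point_inj z z' I I' : unit_sphere I -> unit_sphere I' ->
  slice_point z I = slice_point z' I' ->
  [\/ z = z' /\ complex.Im z = 0, z = z' /\ I = I' | z' = conjc z /\ I' = - I].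
Proof.
case: z z' => [a b] [a' b'] /unit_sphereP[r n] /unit_sphereP[r' n'] E.
have := congr1 (@quat_re _) E; have := congr1 (@quat_i _) E.
have := congr1 (@quat_j _) E; have := congr1 (@quat_k _) E.
rewrite {E} /slice_point /= quat_1E !quat_linE !QuatE !mulr0 !add0r r r'.
rewrite !mulr0 !addr0 !mulr1 => hk hj hi <- {a'}.
have bb : b ^+ 2 = b' ^+ 2.
  rewrite -[b ^+ 2]mulr1 -n -[b' ^+ 2]mulr1 -n' !mulrDr -!exprMn.
  by rewrite hk hj hi.
have [b0|b0] := eqVneq b 0.
  constructor 1; split=> //; congr (_ +i* _).
  by apply/eqP; rewrite eq_sym b0 -sqrf_eq0 -bb b0 expr0n.
move/eqP: bb; rewrite eqf_sqr => /orP[]/eqP bb.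
  constructor 2; split; first by rewrite bb.
  by apply: quatP; rewrite ?r ?r' //; apply: (mulfI b0);
    rewrite ?hi ?hj ?hk bb.
constructor 3; split; first by rewrite /= bb opprK.
apply: quatP; rewrite !quat_linE ?r ?r' ?oppr0 //; apply: (mulfI b0);
  rewrite mulrN ?hi ?hj ?hk bb mulNr //.
Qed.

Lemma plane_circularizationK D :
  conj_invariant D -> plane (circularization D) = D.
Proof.
move=> Dc; apply/seteqP; split=> z.
  case=> I hI [z' [I' [Dz' hI']]].
  case/(slice_point_inj hI hI') => -[e _]; rewrite ?e //.
  by rewrite -[z]conjcK -e; exact: Dc.
by move=> Dz; exists (Quat 0 1 0 0);
  [exact: unit_sphere_i | exists z, (Quat 0 1 0 0); split=> //; exact: unit_sphere_i].
Qed.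

Lemma circularization_planeK Om :
  circular Om -> circularization (plane Om) = Om.
Proof. by case=> D Dc ->; rewrite plane_circularizationK. Qed.

Lemma circular_plane_conj Om : circular Om -> conj_invariant (plane Om).
Proof. by case=> D Dc ->; rewrite plane_circularizationK. Qed.

Lemma slice_funE Om F z I : circular Om -> stem_function (plane Om) F ->
  plane Om z -> unit_sphere I ->
  slice_fun Om F (slice_point z I) = cquat_Re (F z) + I * cquat_Im (F z).
Proof.
move=> cOm sF Dz hI; rewrite /slice_fun; case: xgetP => [y _|]; last first.
  by move=> /(_ (cquat_Re (F z) + I * cquat_Im (F z))) []; exists z, I.
move=> [z' [I' [Dz' hI' /slice_point_inj-/(_ hI hI')]]] [].
- move=> [<- z0] ->.
  have := sF _ Dz; rewrite (_ : conjc z = z); last first.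
    by case: z z0 {Dz} => a b /= ->; rewrite oppr0.
  move/(congr1 (@cquat_Im _)); rewrite cquat_ImE => E.
  suff -> : cquat_Im (F z) = 0 by rewrite !mulr0.
  apply/rowP => n; move/rowP/(_ n): E; rewrite !mxE; lra.
- by move=> [<- <-] ->.
- by move=> [-> ->] ->; rewrite sF // cquat_ReE cquat_ImE mulrNN.
Qed.

Lemma stemE Om F f z : circular Om -> induces Om F f -> plane Om z ->
  stem Om f z = F z.
Proof.
move=> cOm iF Dz; rewrite /stem; case: xgetP => [G _ iG|/(_ F) //].
have Omz I : unit_sphere I -> Om (slice_point z I).
  by move=> hI; rewrite -(circularization_planeK cOm); exists z, I.
have E I : unit_sphere I -> cquat_Re (G z) + I * cquat_Im (G z) =
    cquat_Re (F z) + I * cquat_Im (F z).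
  move=> hI; case: iF iG => sF fF [sG fG].
  by rewrite -!(slice_funE cOm) // -fF ?fG //; exact: Omz.
set J : quat R := Quat 0 1 0 0.
have hJ : unit_sphere J by exact: unit_sphere_i.
have E1 := E _ hJ; have E2 := E _ (unit_sphereN hJ).
rewrite -[G z]cquatK -[F z]cquatK; move: E1 E2.
move: (cquat_Re (G z)) (cquat_Im (G z)) (cquat_Re (F z)) (cquat_Im (F z)).
move=> a b c d E1 E2.
have JJ : J * J = -1 by rewrite -expr2.
have e1 : a = c.
  apply: (@scalerI _ _ (2 : R)); first by rewrite pnatr_eq0.
  rewrite !scaler_nat !mulr2n.
  have := congr2 +%R E1 E2.
  by rewrite !mulNr addrACA subrr addr0 [RHS]addrACA subrr addr0.
move: E1; rewrite e1 => /addrI /(congr1 ( *%R J)).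
by rewrite !mulrA JJ !mulN1r => /oppr_inj ->.
Qed.

End SliceFunctions.

(* Main.v *)
Require Import Defs.
From mathcomp Require Import all_boot all_order all_algebra.
From mathcomp Require Import boolp classical_sets reals topology normedtype derive.
From mathcomp Require Import complex ring.
Import GRing.Theory.
Local Open Scope classical_set_scope.
Local Open Scope ring_scope.

(** The formula is the pointwise shadow of an identity in the algebra of complex
quaternions.  All the operations occurring in it ([star], [sconj], [scal_part],
[vec_part], [star_wedge], [star_inner]) turn slice functions into slice
functions, and act on the stem functions, at each [z], by the corresponding
operation of [quat R[i]].  Writing a complex quaternion as [w = a + w'], where
[a] is its scalar part and [w'] its vector part, one has
[w * v = a b + a v' + b w' + w' * v'], and the product of two vectors splits as
[w' * v' = - (w' * conj v')_0 + (w' * v' - v' * w') / 2] ([quat_mul_scal_vec]).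

Evaluating the stem functions on the slice of an imaginary unit [I], that is
applying [w |-> Re w + I * Im w], is real-linear but not multiplicative.  It
does turn scaling by a complex number [c = x + ı y] into left multiplication by the
quaternion [x + y I] ([slice_evalZ]), so the three products having a
slice-preserving factor become pointwise products, as the formula requires. *)

(** * Complex quaternions *)

Lemma quat_scal_part {K : numFieldType} (w : quat K) :
  2^-1 *: (w + quat_conj w) = (quat_re w)%:A.
Proof.
by apply: quatP; rewrite /quat_conj quat_1E !(QuatE, quat_linE); field.
Qed.

Lemma quat_vec_part {K : numFieldType} (w : quat K) :
  2^-1 *: (w - quat_conj w) = w - (quat_re w)%:A.
Proof.
by apply: quatP; rewrite /quat_conj quat_1E !(QuatE, quat_linE); field.
Qed.

(** A vector satisfies [quat_conj v' = - v'], so the inner product term is the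
scalar part of [w' * v'] and the commutator term its vector part.  The other
products are written as scalings because scaling, unlike the product, is
compatible with evaluation on a slice. *)
Lemma quat_mul_scal_vec {K : numFieldType} (w v : quat K) :
  let w' := w - (quat_re w)%:A in
  let v' := v - (quat_re v)%:A in
  w * v = quat_re w *: (quat_re v)%:A - (quat_re (w' * quat_conj v'))%:A
          + quat_re w *: v' + quat_re v *: w'
          + 2^-1 *: (w' * v' - v' * w').
Proof.
move=> /=; apply: quatP; rewrite !quat_mulE /quat_mul /quat_conj quat_1E;
  by rewrite !(QuatE, quat_linE); field.
Qed.

Section StemCalculus.
Set Implicit Arguments.
Unset Strict Implicit.
Local Open Scope complex_scope.
Variable R : realType.
Implicit Types (Om : set (quat R)) (I : quat R) (c z : R[i]).
Implicit Types (w v : quat R[i]) (F G : R[i] -> quat R[i]).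
Implicit Types (f g : quat R -> quat R).

Lemma cquat_ReD w v : cquat_Re (w + v) = cquat_Re w + cquat_Re v.
Proof. by apply/rowP => n; rewrite !mxE; case: (w 0 n); case: (v 0 n). Qed.

Lemma cquat_ImD w v : cquat_Im (w + v) = cquat_Im w + cquat_Im v.
Proof. by apply/rowP => n; rewrite !mxE; case: (w 0 n); case: (v 0 n). Qed.

Lemma cquat_ReZ c w :
  cquat_Re (c *: w) = complex.Re c *: cquat_Re w - complex.Im c *: cquat_Im w.
Proof. by apply/rowP => n; rewrite !mxE; case: c; case: (w 0 n). Qed.

Lemma cquat_ImZ c w :
  cquat_Im (c *: w) = complex.Re c *: cquat_Im w + complex.Im c *: cquat_Re w.
Proof.
by apply/rowP => n; rewrite !mxE; case: c => x y; case: (w 0 n).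
Qed.

Lemma cquat_conjE w : cquat_conj w = quat_conj w.
Proof.
by apply/rowP => -[[|[|[|[|//]]]] h]; rewrite !mxE /= ?mxE;
  rewrite /quat_re /quat_i /quat_j /quat_k ?mxE; case: (w 0 _).
Qed.

Lemma cquat_barM w v : cquat_bar (w * v) = cquat_bar w * cquat_bar v.
Proof.
rewrite -[w]cquatK -[v]cquatK cquat_mulE /cquat_bar !(cquat_ReE, cquat_ImE).
by rewrite cquat_mulE mulrNN mulrN mulNr opprD.
Qed.

Lemma cquat_barD w v : cquat_bar (w + v) = cquat_bar w + cquat_bar v.
Proof.
apply/rowP => n; rewrite !mxE.
by case: (w 0 n) (v 0 n) => a b [a' b'] /=; rewrite opprD.
Qed.

Lemma cquat_barZ c w : cquat_bar (c *: w) = conjc c *: cquat_bar w.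
Proof.
apply/rowP => n; rewrite !mxE; case: c (w 0 n) => x y [a b] /=.
by apply/eqP; rewrite eq_complex /=; apply/andP; split; apply/eqP; ring.
Qed.

Lemma cquat_barN w : cquat_bar (- w) = - cquat_bar w.
Proof. by apply/rowP => n; rewrite !mxE; case: (w 0 n). Qed.

Lemma cquat_bar_conj w : cquat_bar (cquat_conj w) = cquat_conj (cquat_bar w).
Proof.
rewrite /cquat_bar /cquat_conj !(cquat_ReE, cquat_ImE); congr (cquat _ _).
by apply: quatP; rewrite /quat_conj !(QuatE, quat_linE).
Qed.

(** * Evaluation on a slice *)

Definition slice_eval I w : quat R := cquat_Re w + I * cquat_Im w.

Lemma slice_evalD I w v : slice_eval I (w + v) = slice_eval I w + slice_eval I v.
Proof. by rewrite /slice_eval cquat_ReD cquat_ImD mulrDr addrACA. Qed.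

(** Since [I ^+ 2 = -1], multiplying by [I] on the left agrees with multiplying
by the imaginary unit of the scalars: a complex scalar crosses the evaluation,
whereas a quaternion not commuting with [I] would not. *)
Lemma slice_evalZ I c w : unit_sphere I ->
  slice_eval I (c *: w) = slice_point c I * slice_eval I w.
Proof.
rewrite /unit_sphere /= expr2 => II.
rewrite /slice_eval /slice_point cquat_ReZ cquat_ImZ.
rewrite mulrDl !mulrDr -!scalerAl !mul1r -!scalerAr mulrA II mulN1r scalerN.
by rewrite -!addrA; congr (_ + _); rewrite [RHS]addrA [RHS]addrC.
Qed.

Lemma slice_point_real (x : R) I : slice_point x%:C I = x%:A.
Proof. by rewrite /slice_point /= scale0r addr0. Qed.

Lemma slice_evalN I w : slice_eval I (- w) = - slice_eval I w.
Proof.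
have e0 : slice_eval I 0 = 0.
  by apply: (addrI (slice_eval I 0)); rewrite -slice_evalD !addr0.
by apply: (addrI (slice_eval I w)); rewrite -slice_evalD !subrr.
Qed.

Lemma slice_eval_half I w : unit_sphere I ->
  slice_eval I (2^-1 *: w) = 2^-1 *: slice_eval I w.
Proof.
move=> hI; have -> : (2^-1 : R[i]) = (2^-1 : R)%:C by rewrite fmorphV rmorph_nat.
by rewrite slice_evalZ // slice_point_real -scalerAl mul1r.
Qed.

(** This is why the [*]-product with a slice-preserving factor is the pointwise
one: the stem function of such a factor takes values of the form [c%:A]. *)
Lemma slice_eval_scalM I c w : unit_sphere I ->
  slice_eval I (c *: w) = slice_eval I c%:A * slice_eval I w.
Proof.
move=> hI; rewrite !slice_evalZ //; congr (_ * _).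
suff -> : slice_eval I 1 = 1 by rewrite mulr1.
apply: quatP; rewrite /slice_eval !quat_linE quat_mulE /quat_mul !QuatE.
all: rewrite !quat_1E /quat_re /quat_i /quat_j /quat_k !mxE /=.
all: by rewrite ?(mulr0, subr0, addr0).
Qed.

(** * Stem functions of the operations on slice functions *)

Lemma induces_eval Om F f z I : circular Om -> induces Om F f ->
  plane Om z -> unit_sphere I -> f (slice_point z I) = slice_eval I (F z).
Proof.
move=> cOm [sF fF] Dz hI; rewrite fF ?(slice_funE cOm) //.
by rewrite -(circularization_planeK cOm); exists z, I.
Qed.

(** With [induces_eval], this reduces every closure property below to a
computation in [quat R[i]] at a fixed [z], the compatibility with conjugation
being checked separately. *)
Lemma eval_induces Om F f : circular Om -> stem_function (plane Om) F ->
  (forall z I, plane Om z -> unit_sphere I ->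
     f (slice_point z I) = slice_eval I (F z)) ->
  induces Om F f.
Proof.
move=> cOm sF fF; split=> // q.
rewrite -{1}(circularization_planeK cOm) => -[z [I [Dz hI ->]]].
by rewrite fF // (slice_funE cOm).
Qed.

Lemma stem_function_stem Om F f : circular Om -> induces Om F f ->
  stem_function (plane Om) (stem Om f).
Proof.
move=> cOm iF z Dz; rewrite !(stemE cOm iF) //; last exact: circular_plane_conj.
exact: iF.1.
Qed.

Lemma induces_star Om F G f g : circular Om ->
  induces Om F f -> induces Om G g ->
  induces Om (fun z => F z * G z) (star Om f g).
Proof.
move=> cOm iF iG; apply: eval_induces => // [z Dz|z I Dz hI].
  by rewrite iF.1 // iG.1 // cquat_barM.
have sS : stem_function (plane Om) (fun z => stem Om f z * stem Om g z).
  move=> y Dy; rewrite (stem_function_stem cOm iF Dy).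
  by rewrite (stem_function_stem cOm iG Dy) -cquat_barM.
by rewrite /star (slice_funE cOm sS Dz hI) (stemE cOm iF Dz) (stemE cOm iG Dz).
Qed.

Lemma induces_sconj Om F f : circular Om -> induces Om F f ->
  induces Om (fun z => quat_conj (F z)) (sconj Om f).
Proof.
move=> cOm iF; apply: eval_induces => // [z Dz|z I Dz hI].
  by rewrite iF.1 // -!cquat_conjE cquat_bar_conj.
rewrite /sconj slice_funE // => [|y Dy].
  by rewrite (stemE cOm iF) // cquat_conjE.
by rewrite (stem_function_stem cOm iF) // cquat_bar_conj.
Qed.

Lemma conjc_half : conjc (2^-1 : R[i]) = 2^-1.
Proof. by rewrite fmorphV rmorph_nat. Qed.

Lemma induces_half_add Om F G f g : circular Om ->
  induces Om F f -> induces Om G g ->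
  induces Om (fun z => 2^-1 *: (F z + G z)) (fun q => 2^-1 *: (f q + g q)).
Proof.
move=> cOm iF iG; apply: eval_induces => // [z Dz|z I Dz hI].
  by rewrite iF.1 // iG.1 // cquat_barZ cquat_barD conjc_half.
rewrite slice_eval_half // slice_evalD (induces_eval cOm iF) //.
by rewrite (induces_eval cOm iG).
Qed.

Lemma induces_opp Om F f : circular Om -> induces Om F f ->
  induces Om (fun z => - F z) (fun q => - f q).
Proof.
move=> cOm iF; apply: eval_induces => // [z Dz|z I Dz hI].
  by rewrite iF.1 // cquat_barN.
by rewrite slice_evalN (induces_eval cOm iF).
Qed.

Lemma induces_scal_part Om F f : circular Om -> induces Om F f ->
  induces Om (fun z => (quat_re (F z))%:A) (scal_part Om f).
Proof.
move=> cOm iF; have := induces_half_add cOm iF (induces_sconj cOm iF).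
by under eq_fun do rewrite quat_scal_part.
Qed.

Lemma induces_vec_part Om F f : circular Om -> induces Om F f ->
  induces Om (fun z => F z - (quat_re (F z))%:A) (vec_part Om f).
Proof.
move=> cOm iF.
have := induces_half_add cOm iF (induces_opp cOm (induces_sconj cOm iF)).
under eq_fun do rewrite quat_vec_part.
by [].
Qed.

Lemma induces_star_wedge Om F G f g : circular Om ->
  induces Om F f -> induces Om G g ->
  induces Om (fun z => 2^-1 *: (F z * G z - G z * F z)) (star_wedge Om f g).
Proof.
move=> cOm iF iG; apply: (induces_half_add cOm (induces_star cOm iF iG)).
exact: induces_opp (induces_star cOm iG iF).
Qed.

Lemma induces_star_inner Om F G f g : circular Om ->
  induces Om F f -> induces Om G g ->
  induces Om (fun z => (quat_re (F z * quat_conj (G z)))%:A)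
    (star_inner Om f g).
Proof.
move=> cOm iF iG.
exact: (induces_scal_part cOm (induces_star cOm iF (induces_sconj cOm iG))).
Qed.

End StemCalculus.

Theorem proposition2p7 (R : realType) (Om : set (quat R))
    (f g : quat R -> quat R) :
  Om !=set0 -> circular_domain Om ->
  slice_regular Om f -> slice_regular Om g ->
  forall q : quat R, Om q ->
    star Om f g q =
      scal_part Om f q * scal_part Om g q
      - star_inner Om (vec_part Om f) (vec_part Om g) q
      + scal_part Om f q * vec_part Om g q
      + scal_part Om g q * vec_part Om f q
      + star_wedge Om (vec_part Om f) (vec_part Om g) q.
Proof.
move=> _ [cOm _ _] [F _ iF] [G _ iG] q.
rewrite -{1}(circularization_planeK cOm) => -[z [I [Dz hI ->]]] {q}.
have iFs := induces_scal_part cOm iF; have iGs := induces_scal_part cOm iG.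
have iFv := induces_vec_part cOm iF; have iGv := induces_vec_part cOm iG.
rewrite (induces_eval cOm (induces_star cOm iF iG) Dz hI).
rewrite (induces_eval cOm iFs Dz hI) (induces_eval cOm iGs Dz hI).
rewrite (induces_eval cOm iFv Dz hI) (induces_eval cOm iGv Dz hI).
rewrite (induces_eval cOm (induces_star_inner cOm iFv iGv) Dz hI).
rewrite (induces_eval cOm (induces_star_wedge cOm iFv iGv) Dz hI).
rewrite quat_mul_scal_vec.
(* From here on only the compatibility of the evaluation with sums and
   scalings matters, so the parts of
   [F z] and [G z] are replaced by arbitrary values. *)
move: (quat_re (F z)) (quat_re (G z)) (F z - _) (G z - _) => a b w' v'.
move: (quat_re (w' * _))%:A (2^-1 *: _) => u x.
by rewrite -!(slice_eval_scalM _ _ hI) -slice_evalN -!slice_evalD.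
Qed.
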